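(* Let $\mathfrak A$ be an abelian (possibly non-unital) $C^*$-algebra with Gel'fand spectrum $X=\sigma(\mathfrak A)$, let $\Phi$ be a unital $*$-endomorphism of $\mathfrak A\cong C_0(X)$, and let $\tau:X\to X$ be the continuous proper map with $\Phi(f)=f\circ\tau$ for all $f\in C_0(X)$. Then either $\sigma(\Phi)=\mathbb D$, or $\{\lambda\in\mathbb C:0<|\lambda|<1\}\subset\mathbb C\setminus\sigma(\Phi)$. Moreover: (i) if $\tau(X)\neq X$, then $0\in\sigma(\Phi)$; (ii) if $\tau^{n+1}(X)\neq\tau^n(X)$ for every $n\in\mathbb N$, then $\sigma(\Phi)=\mathbb D$; (iii) if there exists $n_0\in\mathbb N$ with $\tau^{n_0+1}(X)=\tau^{n_0}(X)$, then either $\sigma(\Phi)=\mathbb D$ or $\sigma(\Phi)\subset\mathbb T\cup\{0\}$.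
   Context: $\mathbb D$ is the closed unit disk and $\mathbb T$ the unit circle in $\mathbb C$; $\tau^0$ is the identity. A $*$-endomorphism $\Phi$ of a (possibly non-unital) $C^*$-algebra $\mathfrak A$ is called unital if $\big(\Phi(u_\iota)\big)_{\iota\in I}$ is an approximate unity for $\mathfrak A$ for some (equivalently, every) approximate unity $(u_\iota)_{\iota\in I}$ of $\mathfrak A$; an approximate unity is a net with $u_\iota a\to a$ and $au_\iota\to a$ in norm for all $a$. For such $\Phi$ on $C_0(X)$ there is a unique continuous proper $\tau$ with $\Phi(f)=f\circ\tau$. $\sigma(\Phi)$ is the spectrum of $\Phi$ as a bounded operator on $\mathfrak A$. *)

(* Defs.v *)
From HB Require Import structures.
From mathcomp Require Import all_boot all_order all_algebra.
From mathcomp Require Import all_classical all_reals all_analysis.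
From mathcomp Require Import complex.
Set Implicit Arguments. Unset Strict Implicit. Unset Printing Implicit Defensive.
Import Order.TTheory GRing.Theory Num.Theory ComplexField Normc.
Local Open Scope classical_set_scope.
Local Open Scope ring_scope.

Definition ccontinuous (R : realType) (X : topologicalType) (f : X -> R[i]) :=
  forall x (e : R), 0 < e -> \forall y \near x, normc (f y - f x) < e.

Definition C0 (R : realType) (X : topologicalType) (f : X -> R[i]) :=
  ccontinuous f /\ forall e : R, 0 < e -> compact [set x | e <= normc (f x)].

Definition proper_map (X : topologicalType) (tau : X -> X) :=
  forall K : set X, compact K -> compact (tau @^-1` K).

(* lam is in the resolvent set of the composition operator
   Phi f = f \o tau on the Banach space (C_0(X), sup norm), i.e.
   Phi - lam * id is invertible in B(C_0(X)): bijective on C_0(X)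
   with bounded inverse. *)
Definition comp_resolvent (R : realType) (X : topologicalType) (tau : X -> X)
    (lam : R[i]) : Prop :=
  (forall g, C0 g -> exists f, C0 f /\ forall x, f (tau x) - lam * f x = g x) /\
  (forall f, C0 f -> (forall x, f (tau x) - lam * f x = 0) -> forall x, f x = 0) /\
  (exists M : R, forall f g (c : R), C0 f -> C0 g ->
     (forall x, f (tau x) - lam * f x = g x) ->
     (forall y, normc (g y) <= c) -> forall x, normc (f x) <= M * c).

Definition comp_spectrum (R : realType) (X : topologicalType) (tau : X -> X) :
  set R[i] := [set lam | ~ comp_resolvent tau lam].

Definition cdisk (R : realType) : set R[i] := [set z | normc z <= 1].
Definition ccircle (R : realType) : set R[i] := [set z | normc z = 1].

(* Main.v *)
Require Import Defs.
From HB Require Import structures.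
From mathcomp Require Import all_boot all_order all_algebra.
From mathcomp Require Import all_classical all_reals all_analysis.
From mathcomp Require Import complex ring lra.
Import Order.TTheory GRing.Theory Num.Theory ComplexField Normc.
Import numFieldNormedType.Exports.
Local Open Scope classical_set_scope.
Local Open Scope ring_scope.

(* Write [X_n] for the range of the n-th iterate of [tau]; properness makes it
   closed. For [normc lam > 1] the Neumann series inverts [Phi - lam].
   If the [X_n] decrease strictly, a bump function [h] near a point of
   [X_n \ X_{n+1}], spread along the iterates as a slowly weighted sum of the
   [h \o tau^k], is an approximate eigenvector for every [lam] in the closed disk.
   If [X_{n+1} = X_n =: Y], then [tau] maps [Y] onto [Y]. When it is injective
   there, it is a homeomorphism of [Y], and for [0 < normc lam < 1] the inverse of
   [Phi - lam] is a power series in the inverse map on [Y], propagated to [X] by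
   the functional equation. Otherwise [tau a = tau b] with [a <> b] in [Y], and
   backward orbits [a_k], [b_k] give functionals
   [\sum_k lam ^+ k * (g (a_k) - g (b_k))] which telescope on the range of
   [Phi - lam]; testing them on an interpolating [g] excludes a bounded inverse
   for every [lam] in the closed disk. *)

(** * The complex modulus and geometric series *)

Lemma normc_ge0 (R : rcfType) (x : R[i]) : 0 <= normc x.
Proof. by case: x => a b; exact: sqrtr_ge0. Qed.

Lemma ler_normcD (R : rcfType) (x y : R[i]) :
  normc (x + y) <= normc x + normc y.
Proof. exact: le_normcD. Qed.

Lemma normc_opp (R : rcfType) (x : R[i]) : normc (- x) = normc x.
Proof. exact: normcN. Qed.

Lemma ler_normcB (R : rcfType) (x y : R[i]) :
  normc (x - y) <= normc x + normc y.
Proof. by rewrite -(normc_opp R y); exact: ler_normcD. Qed.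

Lemma normc_distC (R : rcfType) (x y : R[i]) : normc (x - y) = normc (y - x).
Proof. by rewrite -normc_opp opprB. Qed.

Lemma normcX (R : rcfType) (x : R[i]) n : normc (x ^+ n) = normc x ^+ n.
Proof.
by elim: n => [|n IH]; rewrite ?expr0 ?normc1// !exprS normcM IH.
Qed.

Lemma normc_real (R : rcfType) (r : R) : normc r%:C%C = `|r|.
Proof. by rewrite /normc/= expr0n addr0 sqrtr_sqr. Qed.

Lemma normc_eq0 (R : rcfType) (x : R[i]) : (normc x == 0) = (x == 0).
Proof.
by apply/eqP/eqP => [/eq0_normc //|->]; exact: normc0.
Qed.

Lemma ler_normcReIm (R : rcfType) (x : R[i]) :
  normc x <= `|complex.Re x| + `|complex.Im x|.
Proof.
case: x => a b /=; rewrite -(@ler_pXn2r _ 2)// ?nnegrE ?sqrtr_ge0 ?addr_ge0//.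
rewrite sqr_sqrtr ?addr_ge0 ?sqr_ge0// sqrrD !real_normK ?num_real//.
by rewrite addrAC lerDl mulrn_wge0// mulr_ge0.
Qed.

Lemma ler_Re_normc (R : rcfType) (x : R[i]) : `|complex.Re x| <= normc x.
Proof.
by case: x => a b /=; rewrite -sqrtr_sqr ler_wsqrtr// lerDl sqr_ge0.
Qed.

Lemma ler_Im_normc (R : rcfType) (x : R[i]) : `|complex.Im x| <= normc x.
Proof.
by case: x => a b /=; rewrite -sqrtr_sqr ler_wsqrtr// lerDr sqr_ge0.
Qed.

Lemma eq0_of_geometric_bound (R : realType) (w : R[i]) (C q : R) :
  0 <= q < 1 -> (forall n, normc w <= C * q ^+ n) -> w = 0.
Proof.
move=> /andP[q0 q1] hw; apply/eqP; rewrite -normc_eq0 eq_le normc_ge0 andbT.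
have cq : geometric C q n @[n --> \oo] --> (0 : R).
  by apply: cvg_geometric; rewrite ger0_norm.
rewrite -(cvg_lim _ cq)//; apply: limr_ge; first exact: cvgP cq.
by near=> n; exact: hw.
Unshelve. all: by end_near.
Qed.

Lemma geometric_series_remainder (R : realType) (x : nat -> R) (C q : R) :
  0 <= C -> 0 <= q < 1 -> (forall k, `|x k| <= C * q ^+ k) ->
  exists L, forall n, `|L - \sum_(0 <= k < n) x k| <= C * q ^+ n / (1 - q).
Proof.
move=> C0 /andP[q0 q1] hx.
have q1' : `|q| < 1 by rewrite ger0_norm.
have cx : cvgn (series x).
  apply: normed_cvg; apply: (@series_le_cvg _ _ (geometric C q)) => //=.
    by move=> n; rewrite mulr_ge0 ?exprn_ge0.
  exact: is_cvg_geometric_series.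
exists (limn (series x)) => n; apply/ler_addgt0Pr => e e0.
have q1p : 0 < 1 - q by rewrite subr_gt0.
(* The subtracted end term makes the bound telescope, so that the induction on [d] closes. *)
have partial d : `|\sum_(n <= k < n + d) x k| <=
    C * q ^+ n / (1 - q) - C * q ^+ (n + d) / (1 - q).
  elim: d => [|d IH]; first by rewrite addn0 big_geq// normr0 subrr.
  rewrite addnS big_nat_recr ?leq_addr//=.
  apply: (le_trans (ler_normD _ _)); apply: (le_trans (lerD IH (hx _))).
  rewrite exprS le_eqVlt; apply/orP; left; apply/eqP; field.
  by rewrite gt_eqF.
have [m mn hm] : exists2 m, (n <= m)%N & `|limn (series x) - series x m| < e.
  near (\oo : set_system nat) => m; exists m; first by near: m; exists n.
  by near: m; move/cvgrPdist_lt : cx => /(_ _ e0).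
have := partial (m - n)%N; rewrite subnKC// => pm.
rewrite (_ : _ - _ = (limn (series x) - series x m) +
    \sum_(n <= k < m) x k); last first.
  by rewrite /series/= (big_cat_nat _ mn)//= opprD !addrA addrNK.
apply: (le_trans (ler_normD _ _)); rewrite addrC lerD ?(ltW hm)//.
apply: (le_trans pm); rewrite gerBl divr_ge0 ?(ltW q1p)//.
by rewrite mulr_ge0 ?exprn_ge0.
Unshelve. all: by end_near.
Qed.

(** Real and imaginary parts are summed separately; adding the two remainders produces the factor
    2. *)
Lemma complex_geometric_series (R : realType) (z : nat -> R[i]) (C q : R) :
  0 <= C -> 0 <= q < 1 -> (forall k, normc (z k) <= C * q ^+ k) ->
  exists L, forall n,
    normc (L - \sum_(0 <= k < n) z k) <= C *+ 2 / (1 - q) * q ^+ n.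
Proof.
move=> C0 q01 hz.
have [a ha] := geometric_series_remainder _ (fun k => complex.Re (z k)) _ _ C0 q01
  (fun k => le_trans (ler_Re_normc _ _) (hz k)).
have [b hb] := geometric_series_remainder _ (fun k => complex.Im (z k)) _ _ C0 q01
  (fun k => le_trans (ler_Im_normc _ _) (hz k)).
exists (a +i* b)%C => n; apply: (le_trans (ler_normcReIm _ _)).
have -> : \sum_(0 <= k < n) z k =
    ((\sum_(0 <= k < n) complex.Re (z k)) +i* (\sum_(0 <= k < n) complex.Im (z k)))%C.
  elim: n => [|n IH]; first by rewrite !big_geq.
  by rewrite !big_nat_recr//= IH; case: (z n).
rewrite /=; apply: (le_trans (lerD (ha n) (hb n))).
by rewrite -mulr2n -mulrnAl -mulrnAl mulrAC.
Qed.

(** * The function space $C_0(X)$ *)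

Lemma ccontinuous_normc (R : realType) (X : topologicalType) (f : X -> R[i]) :
  ccontinuous f -> continuous (fun x => normc (f x)).
Proof.
move=> cf x; apply/cvgrPdist_lt => e e0; near=> y.
have : normc (f y - f x) < e by near: y; exact: cf.
apply: le_lt_trans; rewrite ler_norml; apply/andP; split.
  rewrite lerNl opprB lerBlDr; apply: (le_trans _ (ler_normcD _ _ _)).
  by rewrite subrK.
by rewrite lerBlDr normc_distC; apply: (le_trans _ (ler_normcD _ _ _)); rewrite subrK.
Unshelve. all: by end_near.
Qed.

Lemma closed_normc_ge (R : realType) (X : topologicalType) (f : X -> R[i]) (e : R) :
  ccontinuous f -> closed [set x | e <= normc (f x)].
Proof.
move=> /ccontinuous_normc cf.
by apply: (@preimage_closed _ _ _ [set y | e <= y]) => //; exact: closed_ge.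
Qed.

Lemma C0_intro (R : realType) (X : topologicalType) (f : X -> R[i]) :
  ccontinuous f ->
  (forall e : R, 0 < e ->
     exists2 K, compact K & forall x, e <= normc (f x) -> K x) ->
  C0 f.
Proof.
move=> cf hf; split=> // e /hf[K cK fK].
exact: subclosed_compact (closed_normc_ge _ _ _ _ cf) cK fK.
Qed.

(** Where the modulus is at least 1 the domain is compact, so the image is bounded; elsewhere 1 is a
    bound. *)
Lemma C0_bounded (R : realType) (X : topologicalType) (f : X -> R[i]) :
  C0 f -> exists2 B : R, 0 <= B & forall x, normc (f x) <= B.
Proof.
move=> [cf hf].
have : compact [set normc (f x) | x in [set x | 1 <= normc (f x)]].
  apply: continuous_compact; last exact: hf.
  by apply: continuous_subspaceT; exact: ccontinuous_normc.
move=> /compact_bounded[M [_ hM]].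
exists (`|M| + 1) => [|x]; first by rewrite addr_ge0.
have [h1|/ltW h1] := leP 1 (normc (f x)); last first.
  by rewrite (le_trans h1)// lerDr.
rewrite -[normc _]ger0_norm ?normc_ge0//.
apply: (hM (`|M| + 1)); last by exists x.
by rewrite (le_lt_trans (ler_norm _))// ltrDl.
Qed.

Lemma ccontinuousD (R : realType) (X : topologicalType) (f g : X -> R[i]) :
  ccontinuous f -> ccontinuous g -> ccontinuous (fun x => f x + g x).
Proof.
move=> cf cg x e e0; have e2 : 0 < e / 2 by rewrite divr_gt0.
near=> y.
rewrite opprD addrACA (le_lt_trans (ler_normcD _ _ _))// (splitr e) ltrD//.
  by near: y; exact: cf.
by near: y; exact: cg.
Unshelve. all: by end_near.
Qed.

Lemma C0D (R : realType) (X : topologicalType) (f g : X -> R[i]) :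
  C0 f -> C0 g -> C0 (fun x => f x + g x).
Proof.
move=> [cf kf] [cg kg]; apply: C0_intro; first exact: ccontinuousD.
move=> e e0; have e2 : 0 < e / 2 by rewrite divr_gt0.
exists ([set x | e / 2 <= normc (f x)] `|` [set x | e / 2 <= normc (g x)]).
  by apply: compactU; [exact: kf | exact: kg].
move=> x fg; have [|fx] := leP (e / 2) (normc (f x)); first by left.
right; rewrite /= leNgt; apply/negP => gx.
have := le_lt_trans (le_trans fg (ler_normcD _ _ _)) (ltrD fx gx).
by rewrite -splitr ltxx.
Qed.

Lemma C0Ml (R : realType) (X : topologicalType) (h f : X -> R[i]) (B : R) :
  ccontinuous h -> (forall x, normc (h x) <= B) -> C0 f ->
  C0 (fun x => h x * f x).
Proof.
move=> ch hB /[dup] /C0_bounded[M M0 fM] [cf kf].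
have M1 : 0 < M + 1 by rewrite ltr_wpDl.
pose B' := `|B| + 1; have B0 : 0 < B' by rewrite ltr_wpDl.
have hB' x : normc (h x) <= B'.
  by rewrite (le_trans (hB x))// (le_trans (ler_norm _))// lerDl.
apply: C0_intro.
  move=> x e e0; near=> y.
  rewrite (_ : _ - _ = h y * (f y - f x) + (h y - h x) * f x); last by ring.
  rewrite (le_lt_trans (ler_normcD _ _ _))// (splitr e) !normcM ltrD//.
    rewrite (le_lt_trans (ler_wpM2r (normc_ge0 _ _) (hB' y)))// mulrC.
    rewrite -ltr_pdivlMr//; near: y; apply: cf.
    by rewrite !divr_gt0.
  rewrite (@le_lt_trans _ _ (normc (h y - h x) * (M + 1)))//.
    by rewrite ler_wpM2l ?normc_ge0// (le_trans (fM x))// lerDl.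
  by rewrite -ltr_pdivlMr//; near: y; apply: ch; rewrite !divr_gt0.
move=> e e0; exists [set x | e / B' <= normc (f x)].
  by apply: kf; rewrite divr_gt0.
move=> x; rewrite normcM /= ler_pdivrMr// => /le_trans; apply.
by rewrite mulrC ler_wpM2l ?normc_ge0.
Unshelve. all: by end_near.
Qed.

Lemma ccontinuous_cst (R : realType) (X : topologicalType) (c : R[i]) :
  ccontinuous (fun _ : X => c).
Proof. by move=> x e e0; near=> y; rewrite subrr normc0. Unshelve. all: by end_near. Qed.

Lemma C0Z (R : realType) (X : topologicalType) (c : R[i]) (f : X -> R[i]) :
  C0 f -> C0 (fun x => c * f x).
Proof. exact: (C0Ml _ _ _ _ (normc c) (ccontinuous_cst _ _ _)). Qed.

Lemma C0_0 (R : realType) (X : topologicalType) : C0 (fun _ : X => 0 : R[i]).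
Proof.
apply: C0_intro; first exact: ccontinuous_cst.
move=> e e0; exists set0; first exact: compact0.
by move=> x; rewrite normc0 leNgt e0.
Qed.

Lemma C0_sum (R : realType) (X : topologicalType) n (F : nat -> X -> R[i]) :
  (forall k, C0 (F k)) -> C0 (fun x => \sum_(0 <= k < n) F k x).
Proof.
move=> cF; elim: n => [|n IH].
  rewrite (_ : (fun _ => _) = (fun _ : X => 0 : R[i])); first exact: C0_0.
  by apply/funext => x; rewrite big_geq.
rewrite (_ : (fun _ => _) = (fun x => \sum_(0 <= k < n) F k x + F n x)).
  exact: C0D.
by apply/funext => x; rewrite big_nat_recr.
Qed.

Lemma C0_comp (R : realType) (X : topologicalType) (u : X -> X) (f : X -> R[i]) :
  continuous u -> proper_map u -> C0 f -> C0 (fun x => f (u x)).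
Proof.
move=> cu pu [cf kf]; split; last by move=> e /kf /pu.
by move=> x e e0; exact: (cu x _ (cf (u x) e e0)).
Qed.

Lemma C0_uniform_limit (R : realType) (X : topologicalType) (f : X -> R[i]) :
  (forall e : R, 0 < e ->
     exists2 g, C0 g & forall x, normc (f x - g x) < e) ->
  C0 f.
Proof.
move=> hf; apply: C0_intro.
  move=> x e e0; have e3 : 0 < e / 3 by rewrite divr_gt0.
  have [g [cg _] fg] := hf _ e3; near=> y.
  rewrite (_ : _ - _ = (f y - g y) + (g y - g x) + (g x - f x)); last by ring.
  rewrite (le_lt_trans (ler_normcD _ _ _))//.
  rewrite (@lt_le_trans _ _ ((e / 3 + e / 3) + e / 3))//; last by lra.
  apply: ltrD; last by rewrite normc_distC.
  rewrite (le_lt_trans (ler_normcD _ _ _))// ltrD//.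
  by near: y; exact: cg.
move=> e e0; have e2 : 0 < e / 2 by rewrite divr_gt0.
have [g [_ kg] fg] := hf _ e2; exists [set x | e / 2 <= normc (g x)]; first exact: kg.
move=> x /= ex; rewrite leNgt; apply/negP => gx.
have := ltrD (fg x) gx; rewrite -splitr ltNge => /negP; apply.
by apply: (le_trans ex); rewrite (le_trans _ (ler_normcD _ _ _))// subrK.
Unshelve. all: by end_near.
Qed.

Lemma ler_normc_sum (R : rcfType) n (z : nat -> R[i]) :
  normc (\sum_(0 <= k < n) z k) <= \sum_(0 <= k < n) normc (z k).
Proof.
elim: n => [|n IH]; first by rewrite !big_geq// normc0.
rewrite !big_nat_recr//=; apply: (le_trans (ler_normcD _ _ _)).
by rewrite lerD2r.
Qed.

(** [F] is the sum of the [mu ^+ k * g (u k x)]. The condition on [x] and [y] says that the sequence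
    of [y] is that of [x] delayed by one step, so splitting off the first term gives the equation. A
    general sequence [u] covers both forward iterates of [tau] and iterates of its inverse on a
    stable range. *)
Lemma C0_power_series (R : realType) (X : topologicalType)
    (u : nat -> X -> X) (g : X -> R[i]) (mu : R[i]) :
  C0 g -> (forall k, C0 (fun x => g (u k x))) -> normc mu < 1 ->
  exists2 F, C0 F & forall x y, (forall k, u k.+1 y = u k x) ->
    F y = g (u 0%N y) + mu * F x.
Proof.
move=> g0 gu mu1; have [B B0 gB] := C0_bounded _ _ _ g0.
set q := normc mu; have q01 : 0 <= q < 1 by rewrite normc_ge0.
have /choice[F hF] (x : X) : exists L, forall n,
    normc (L - \sum_(0 <= k < n) mu ^+ k * g (u k x)) <= B *+ 2 / (1 - q) * q ^+ n.
  apply: complex_geometric_series => // k.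
  by rewrite normcM normcX mulrC ler_wpM2r// exprn_ge0// normc_ge0.
set C := B *+ 2 / (1 - q) in hF.
have Cq : geometric C q n @[n --> \oo] --> (0 : R).
  by apply: cvg_geometric; rewrite ger0_norm// normc_ge0.
exists F.
  apply: C0_uniform_limit => e e0.
  have [n hn] : exists n, C * q ^+ n < e.
    near (\oo : set_system nat) => n; exists n.
    apply: (le_lt_trans (ler_norm _)); rewrite -normrN -sub0r; near: n.
    by move/cvgrPdist_lt : Cq => /(_ _ e0).
  exists (fun x => \sum_(0 <= k < n) mu ^+ k * g (u k x)).
    by apply: C0_sum => k; exact: C0Z.
  by move=> x; exact: le_lt_trans (hF x n) hn.
move=> x y uxy; apply/eqP; rewrite -subr_eq0; apply/eqP.
(* The partial sum of length [n.+1] at [y] is compared with that of length [n] at [x]; each of the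
   two remainders contributes [C * q ^+ n.+1]. *)
apply: (eq0_of_geometric_bound _ _ (C * q *+ 2) q) => // n.
have := hF y n.+1; have := hF x n.
rewrite big_nat_recl//= expr0 mul1r.
have -> : \sum_(0 <= i < n) mu ^+ i.+1 * g (u i.+1 y) =
    mu * \sum_(0 <= k < n) mu ^+ k * g (u k x).
  by rewrite mulr_sumr; apply: eq_bigr => i _; rewrite uxy exprS mulrA.
set S := \sum_(0 <= k < n) _ => hx hy.
rewrite (_ : _ - _ = (F y - (g (u 0%N y) + mu * S)) - mu * (F x - S)); last by ring.
apply: (le_trans (ler_normcB _ _ _)); rewrite mulr2n mulrDl lerD//.
  by rewrite -mulrA -exprS.
rewrite normcM (mulrC C) -mulrA ler_wpM2l ?normc_ge0//.
Unshelve. all: by end_near.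
Qed.

(** * A priori bounds and the resolvent *)

(** The supremum [S] of [phi] over [P] is finite thanks to [B] and satisfies [S <= q * S + c]. Since
    the resulting bound involves only [c] and [q], it yields resolvent estimates uniform in [f]. *)
Lemma contraction_bound (R : realType) (T : Type) (P : set T) (phi : T -> R)
    (q c B : R) : 0 <= q < 1 ->
  (forall x, P x -> phi x <= B) ->
  (forall x, P x -> exists2 y, P y & phi x <= q * phi y + c) ->
  forall x, P x -> phi x <= c / (1 - q).
Proof.
move=> /andP[q0 q1] hB hP x Px.
have hs : has_sup (phi @` P).
  by split; [exists (phi x), x | exists B => _ [y Py <-]; exact: hB].
have le_sup y : P y -> phi y <= sup (phi @` P).
  by move=> Py; apply: (ub_le_sup hs.2); exists y.
apply: (le_trans (le_sup _ Px)); rewrite ler_pdivlMr ?subr_gt0//.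
rewrite mulrBr mulr1 lerBlDr addrC; apply: (ge_sup hs.1) => _ [y Py <-].
have [z Pz /le_trans] := hP _ Py; apply.
by rewrite lerD2r mulrC ler_wpM2r// le_sup.
Qed.

(** Injectivity is the a priori bound at [g = 0] and [c = 0]. *)
Lemma comp_resolvent_intro (R : realType) (X : topologicalType) (tau : X -> X)
    (lam : R[i]) :
  (forall g, C0 g -> exists f, C0 f /\ forall x, f (tau x) - lam * f x = g x) ->
  (exists M : R, forall f g (c : R), C0 f ->
     (forall x, f (tau x) - lam * f x = g x) ->
     (forall y, normc (g y) <= c) -> forall x, normc (f x) <= M * c) ->
  comp_resolvent tau lam.
Proof.
move=> hs [M hM]; split=> //; split; last first.
  by exists M => f g c cf _; exact: hM.
move=> f cf f0 x; apply/eqP; rewrite -normc_eq0 eq_le normc_ge0 andbT.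
rewrite -[leRHS](mulr0 M); apply: (hM f (fun=> 0)) => // y.
by rewrite normc0.
Qed.

(** * Iterates of proper maps and their ranges *)

Lemma continuous_iter (X : topologicalType) (u : X -> X) n :
  continuous u -> continuous (iter n u).
Proof.
move=> cu; elim: n => [|n IH] x; first exact: cvg_id.
by apply: continuous_comp; [exact: IH | exact: cu].
Qed.

Lemma proper_iter (X : topologicalType) (u : X -> X) n :
  proper_map u -> proper_map (iter n u).
Proof.
by move=> pu; elim: n => [|n IH] K cK //=; exact: (IH _ (pu _ cK)).
Qed.

Lemma compact_nbhs (X : topologicalType) (x : X) :
  locally_compact [set: X] -> exists2 K, nbhs x K & compact K.
Proof.
move=> /(_ x I)[K nK [cK _]]; exists K => //.
by apply: (@filterS _ _ (nbhs_filter x) _ _ _ nK) => y; exact.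
Qed.

(** Closedness is local: over a compact neighbourhood [K] of a limit point [p], the relevant part of
    the image is the image of a compact set, hence closed, and it still has [p] in its closure. *)
Lemma proper_map_closed (X : topologicalType) (u : X -> X) (C : set X) :
  hausdorff_space X -> locally_compact [set: X] ->
  continuous u -> proper_map u -> closed C -> closed (u @` C).
Proof.
move=> hX lcX cu pu cC p clp.
have [K nK cK] := compact_nbhs _ p lcX.
have : closed (u @` (u @^-1` K `&` C)).
  apply: (compact_closed hX); apply: continuous_compact.
    exact: continuous_subspaceT.
  exact: compact_closedI (pu _ cK) cC.
have : closure (u @` (u @^-1` K `&` C)) p.
  move=> B nB; have [_ [[c Cc <-] [Bc Kc]]] := clp _ (filterI nB nK).
  by exists (u c); split => //; exists c.
by move=> + cl => /cl[c [_ Cc] <-]; exists c.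
Qed.

Lemma iter_range_closed (X : topologicalType) (u : X -> X) n :
  hausdorff_space X -> locally_compact [set: X] ->
  continuous u -> proper_map u -> closed (range (iter n u)).
Proof.
move=> hX lcX cu pu; apply: proper_map_closed => //.
- exact: continuous_iter.
- exact: proper_iter.
Qed.

(** * Bump functions and interpolation *)

Lemma ccontinuous_real (R : realType) (X : topologicalType) (h : X -> R) :
  continuous h -> ccontinuous (fun x => (h x)%:C%C).
Proof.
move=> ch x e e0; near=> y; rewrite -rmorphB normc_real distrC; near: y.
by have /cvgrPdist_lt := ch x; apply.
Unshelve. all: by end_near.
Qed.

(** Complete regularity separates [x] from the complement of an open [V] inside both [U] and a
    compact set; the latter gives vanishing at infinity. *)
Lemma C0_bump (R : realType) (X : topologicalType) (x : X) (U : set X) :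
  hausdorff_space X -> locally_compact [set: X] -> nbhs x U ->
  exists h : X -> R, [/\ continuous h, forall y, 0 <= h y <= 1, h x = 1,
    forall y, ~ U y -> h y = 0 & C0 (fun y => (h y)%:C%C)].
Proof.
move=> hX lcX nU; have [K nK cK] := compact_nbhs _ x lcX.
have : nbhs x (U `&` K) by exact: filterI.
rewrite nbhsE => -[V [oV Vx] VUK].
have /(@uniform_separatorP _ R)[f [cf f01 fx fV]] : uniform_separator [set x] (~` V).
  apply: (@locally_compact_completely_regular X R lcX hX) => //.
  exact: open_closedC.
have h01 y : 0 <= 1 - f y <= 1.
  have : `[0, 1]%classic (f y) by apply: f01; exists y.
  by rewrite /= in_itv/= subr_ge0 gerBl andbC.
have hV y : ~ V y -> 1 - f y = 0.
  by move=> nV; rewrite (fV (f y)) ?subrr//; exists y.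
have ch : continuous (fun y => 1 - f y).
  by move=> y; apply: cvgB; [exact: cvg_cst | exact: cf].
exists (fun y => 1 - f y); split => //.
- by rewrite (fx (f x)) ?subr0//; exists x.
- by move=> y nU'; apply: hV => /VUK[].
- apply: C0_intro; first exact: ccontinuous_real.
  move=> e e0; exists K => // y; rewrite normc_real => ey.
  have [/VUK[]//|/hV hy] := pselect (V y).
  by move: ey; rewrite hy normr0 leNgt e0.
Qed.

(** Points are added one at a time: with a bump [h] at the new point [p] vanishing at the old ones,
    the convex combination of [g] and the constant [w p] with weight [h] keeps the bound 1. *)
Lemma C0_interpolation (R : realType) (X : topologicalType) (s : seq X)
    (w : X -> R[i]) :
  hausdorff_space X -> locally_compact [set: X] ->
  (forall x, normc (w x) <= 1) ->
  exists g, [/\ C0 g, forall x, normc (g x) <= 1 & forall x, x \in s -> g x = w x].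
Proof.
move=> hX lcX w1; elim: s => [|p s [g [g0 g1 gw]]].
  by exists (fun=> 0); split => //; [exact: C0_0 | move=> x; rewrite normc0].
have [ps|ps] := boolP (p \in s).
  exists g; split => // x; rewrite inE => /predU1P[->|]; exact: gw.
have nU : nbhs p (~` [set` s]).
  apply: open_nbhs_nbhs; split; last exact/negP.
  apply: closed_openC; apply: (accessible_finite_set_closed.1 (hausdorff_accessible hX)).
  exact: finite_seq.
have [h [ch h01 hp hs h0]] := C0_bump R X p _ hX lcX nU.
have ch' : continuous (fun x => 1 - h x).
  by move=> y; apply: cvgB; [exact: cvg_cst | exact: ch].
exists (fun x => (1 - h x)%:C%C * g x + w p * (h x)%:C%C); split.
- apply: C0D; last exact: C0Z.
  apply: (C0Ml _ _ _ _ 1) => //; first exact: ccontinuous_real.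
  move=> x; rewrite normc_real; have /andP[h0x h1x] := h01 x.
  by rewrite ger0_norm ?subr_ge0// gerBl.
- move=> x; have /andP[h0x h1x] := h01 x.
  apply: (le_trans (ler_normcD _ _ _)).
  rewrite !normcM !normc_real (ger0_norm h0x) ger0_norm ?subr_ge0//.
  rewrite -[leRHS](subrK (h x)) lerD// ?ler_piMr ?ler_piMl ?subr_ge0//.
- move=> x; rewrite inE => /predU1P[->|xs].
    by rewrite hp subrr mul0r add0r mulr1.
  by rewrite hs ?subr0 ?mul1r ?mulr0 ?addr0 ?gw// => /(_ xs).
Qed.

(** * The exterior of the disk *)

Lemma comp_resolvent_gt1 (R : realType) (X : topologicalType) (tau : X -> X)
    (lam : R[i]) :
  continuous tau -> proper_map tau -> 1 < normc lam -> comp_resolvent tau lam.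
Proof.
move=> tc tp l1; have l0 : lam != 0.
  by rewrite -normc_eq0 gt_eqF// (lt_trans ltr01).
have nl0 : 0 < normc lam by rewrite (lt_trans ltr01).
apply: comp_resolvent_intro => [g g0|].
  have [||F F0 hF] := C0_power_series _ _ (fun k => iter k tau) g lam^-1 g0.
  - by move=> k; apply: C0_comp => //; [exact: continuous_iter | exact: proper_iter].
  - by rewrite normcV invf_lt1.
  exists (fun x => - lam^-1 * F x); split; first exact: C0Z.
  move=> x; rewrite (hF (tau x) x)/=; last by move=> k; rewrite -iterSr.
  by field.
exists ((normc lam)^-1 / (1 - (normc lam)^-1)) => f g c f0 fg gc x.
have [B _ fB] := C0_bounded _ _ _ f0.
(* From [lam * f y = f (tau y) - g y], the modulus of [f] contracts along [tau] with factor
   [(normc lam)^-1]. *)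
rewrite mulrAC; apply: (contraction_bound _ _ setT (fun y => normc (f y)) _ _ B) => //.
  by rewrite invf_lt1// l1 andbT invr_ge0 ltW.
move=> y _; exists (tau y) => //=; rewrite -mulrDr mulrC ler_pdivlMr//.
rewrite mulrC -normcM (_ : lam * f y = f (tau y) - g y).
  by rewrite (le_trans (ler_normcB _ _ _))// lerD2l.
by rewrite -fg; ring.
Qed.

(** * Stable range, injective case *)

(** On [Y] the section [s] inverts [tau], so preimages under [s] are images under [tau], which
    preserves closed and compact sets. Nothing is known of [s] off [Y]; hence the composition with
    [w], whose values lie in [Y]. *)
Lemma section_lift_continuous_proper (X : topologicalType) (tau s w : X -> X)
    (Y : set X) :
  hausdorff_space X -> locally_compact [set: X] ->
  continuous tau -> proper_map tau -> closed Y ->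
  (forall y, Y y -> Y (s y) /\ tau (s y) = y) ->
  (forall x y, Y x -> Y y -> tau x = tau y -> x = y) ->
  continuous w -> proper_map w -> (forall x, Y (w x)) ->
  continuous (fun x => s (w x)) /\ proper_map (fun x => s (w x)).
Proof.
move=> hX lcX tc tp cY hs inj cw pw Yw.
have lift C : (fun x => s (w x)) @^-1` C = w @^-1` (tau @` (C `&` Y)).
  apply/seteqP; split=> x /=.
    by move=> Cx; have [Ys ts] := hs _ (Yw x); exists (s (w x)).
  move=> [c [Cc Yc] cw']; have [Ys ts] := hs _ (Yw x).
  by rewrite (inj _ c Ys Yc)// ts.
split.
  apply/continuous_closedP => C cC; rewrite lift.
  apply: preimage_closed => //.
  by apply: proper_map_closed => //; exact: closedI.
move=> K cK; rewrite lift; apply: pw; apply: continuous_compact.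
  exact: continuous_subspaceT.
exact: compact_closedI.
Qed.

Lemma range_iter_tau (X : Type) (tau : X -> X) n y :
  range (iter n tau) y -> range (iter n tau) (tau y).
Proof. by move=> [z _ <-]; exists (tau z) => //; rewrite -iterSr. Qed.

Lemma stable_range_section (X : Type) (tau : X -> X) n :
  range (iter n.+1 tau) = range (iter n tau) ->
  exists s, forall y, range (iter n tau) y ->
    range (iter n tau) (s y) /\ tau (s y) = y.
Proof.
move=> hn; suff /choice[s hs] (y : X) : exists z, range (iter n tau) y ->
    range (iter n tau) z /\ tau z = y by exists s.
have [Yy|] := pselect (range (iter n tau) y); last by exists y.
have [z _ <-] : range (iter n.+1 tau) y by rewrite hn.
by exists (iter n tau z) => _; split => //; exists z.
Qed.

Lemma comp_resolvent_injective (R : realType) (X : topologicalType)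
    (tau : X -> X) n (lam : R[i]) :
  hausdorff_space X -> locally_compact [set: X] ->
  continuous tau -> proper_map tau ->
  range (iter n.+1 tau) = range (iter n tau) ->
  (forall x y, range (iter n tau) x -> range (iter n tau) y ->
     tau x = tau y -> x = y) ->
  0 < normc lam < 1 -> comp_resolvent tau lam.
Proof.
move=> hX lcX tc tp hn inj /andP[l0 l1].
set Y := range (iter n tau) in hn inj.
have ln0 : lam != 0 by rewrite -normc_eq0 gt_eqF.
have [s hs] := stable_range_section _ _ _ hn.
have sK y : Y y -> s (tau y) = y.
  move=> Yy; have [Ys ts] := hs _ (range_iter_tau _ _ _ _ Yy).
  exact: inj.
apply: comp_resolvent_intro => [g g0|].
  (* The map [iter n tau] brings every point into [Y], after which [tau] can be inverted any number
     of times. *)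
  have cpY k : [/\ continuous (fun x => iter k s (iter n tau x)),
      proper_map (fun x => iter k s (iter n tau x)) &
      forall x, Y (iter k s (iter n tau x))].
    elim: k => [|k [ck pk Yk]].
      split; [exact: continuous_iter | exact: proper_iter |].
      by move=> x; exists x.
    have cY : closed Y by exact: iter_range_closed.
    have [] := section_lift_continuous_proper _ _ _ _ _ hX lcX tc tp cY hs inj ck pk Yk.
    by move=> ? ?; split => // x; have [] := hs _ (Yk x).
  have [|//|F F0 hF] :=
      C0_power_series _ _ (fun k x => iter k.+1 s (iter n tau x)) g lam g0.
    by move=> k; have [? ? _] := cpY k.+1; exact: C0_comp.
  have FT x : F (tau x) = g (iter n tau x) + lam * F x.
    rewrite (hF x (tau x)); last first.
      by move=> k; rewrite -iterSr iterSr iterS sK//; exists x.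
    by rewrite -iterSr/= sK//; exists x.
  pose mu := lam^-1.
  (* [F x] is the value the solution must take at [iter n tau x]. Unrolling
     [f (tau x) = lam * f x + g x] along the first [n] steps and solving for [f x] gives this
     formula. *)
  exists (fun x => mu ^+ n * F x +
      (-1) * \sum_(0 <= k < n) mu ^+ k.+1 * g (iter k tau x)); split.
    apply: C0D; first exact: C0Z.
    apply: C0Z; apply: C0_sum => k; apply: C0Z.
    by apply: C0_comp => //; [exact: continuous_iter | exact: proper_iter].
  move=> x; pose G k := mu ^+ k * g (iter k tau x).
  have -> : \sum_(0 <= k < n) mu ^+ k.+1 * g (iter k tau (tau x)) =
      \sum_(0 <= k < n) G k.+1.
    by apply: eq_bigr => k _; rewrite /G iterSr.
  have e2 : lam * \sum_(0 <= k < n) mu ^+ k.+1 * g (iter k tau x) =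
      \sum_(0 <= k < n) G k.
    rewrite mulr_sumr; apply: eq_bigr => k _.
    by rewrite /G exprS !mulrA /mu mulfV// mul1r.
  have := telescope_sumr G (leq0n n); rewrite sumrB => e3.
  rewrite FT mulrDr -[mu ^+ n * g _]/(G n).
  rewrite (_ : g x = G 0%N); last by rewrite /G expr0 mul1r.
  rewrite mulrDr !mulN1r mulrN e2.
  move: e3; set S1 := \sum_(_ <= _ < _) G _.+1; set S2 := \sum_(_ <= _ < _) G _.
  move=> /eqP; rewrite subr_eq => /eqP ->.
  by ring.
(* Induction on the number of steps needed to enter [Y]. On [Y] the identity
   [f y = lam * f (s y) + g (s y)] is a contraction; each step back from [Y] costs a division by
   [normc lam]. *)
have bound m : exists M : R, forall f g (c : R), C0 f ->
     (forall x, f (tau x) - lam * f x = g x) ->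
     (forall y, normc (g y) <= c) ->
     forall x, Y (iter m tau x) -> normc (f x) <= M * c.
  elim: m => [|m [M hM]].
    exists (1 - normc lam)^-1 => f g c f0 fg gc x Yx.
    have [B _ fB] := C0_bounded _ _ _ f0.
    rewrite mulrC; apply: (contraction_bound _ _ Y (fun y => normc (f y)) _ _ B) => //.
      by rewrite normc_ge0.
    move=> y Yy; have [Ys ts] := hs _ Yy; exists (s y) => //=.
    rewrite (_ : f y = lam * f (s y) + g (s y)); last by rewrite -fg ts; ring.
    by rewrite (le_trans (ler_normcD _ _ _))// normcM lerD2l.
  exists ((M + 1) / normc lam) => f g c f0 fg gc x; rewrite iterSr => Yx.
  rewrite mulrAC ler_pdivlMr// mulrC -normcM.
  rewrite (_ : lam * f x = f (tau x) - g x); last by rewrite -fg; ring.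
  rewrite (le_trans (ler_normcB _ _ _))// mulrDl mul1r lerD//.
  exact: (hM f g).
have [M hM] := bound n; exists M => f g c f0 fg gc x.
by apply: (hM f g) => //; exists x.
Qed.

(** * Stable range, non-injective case *)

(** If [a] is periodic, its cycle is run backwards; meeting [b] there would make [b] periodic.
    Otherwise [s] is iterated; meeting [b] would make [a] periodic, because [tau a = tau b]. *)
Lemma backward_orbit_avoiding (X : Type) (tau s : X -> X) (Y : set X) (a b : X) :
  (forall y, Y y -> Y (s y) /\ tau (s y) = y) -> Y a -> a <> b ->
  tau a = tau b -> (forall m, iter m.+1 tau b <> b) ->
  exists a_ : nat -> X,
    [/\ a_ 0%N = a, forall k, tau (a_ k.+1) = a_ k & forall k, a_ k <> b].
Proof.
move=> hs Ya ab tab bper.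
have [[m am]|aper] := pselect (exists m, iter m.+1 tau a = a).
  (* Modulo the period [m.+1], advancing by [m] is going back by one. *)
  exists (fun k => iter (m * k) tau a); split => //.
  - by rewrite muln0.
  - by move=> k; rewrite -iterS mulnSr -addnS iterD am.
  - move=> k ek; apply: (bper m); rewrite -ek -iterD addnC iterD.
    by rewrite am.
have Yk k : Y (iter k s a) by elim: k => // k /hs[].
have tk k : iter k tau (iter k s a) = a.
  by elim: k => // k IH; rewrite iterSr iterS (hs _ (Yk k)).2.
exists (fun k => iter k s a); split => // k; first by rewrite iterS (hs _ (Yk k)).2.
case: k => [//|k] ek; apply: aper; exists k.
by rewrite iterSr tab -iterSr -ek tk.
Qed.

Lemma not_comp_resolvent_two_orbits (R : realType) (X : topologicalType)
    (tau : X -> X) (a b : nat -> X) (lam : R[i]) :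
  hausdorff_space X -> locally_compact [set: X] ->
  (forall k, tau (a k.+1) = a k) -> (forall k, tau (b k.+1) = b k) ->
  tau (a 0%N) = tau (b 0%N) -> injective b -> (forall j k, a j <> b k) ->
  normc lam <= 1 -> ~ comp_resolvent tau lam.
Proof.
move=> hX lcX ta tb tab injb ab l1 [surj [_ [M hM]]].
(* The power [lam ^+ n] is cancelled below, so it must not vanish; for [lam = 0] the choice [n = 0]
   suffices. *)
have [n ln0 nM] : exists2 n, lam ^+ n != 0 & normc lam * (`|M| *+ 2) < n.+1%:R.
  have [->|l0] := eqVneq lam 0.
    by exists 0%N; rewrite ?expr0 ?oner_eq0// normc0 mul0r.
  exists (Num.truncn (`|M| *+ 2)); first by rewrite expf_eq0 negb_and l0 orbT.
  rewrite (@le_lt_trans _ _ (`|M| *+ 2))// ?ler_piMl ?mulrn_wge0//.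
  exact: truncnS_gt.
pose s := mkseq b n.+1.
(* With value [lam ^+ (n - k)] at [b k] and 0 at [a k], every term of the telescoping sum equals
   [- lam ^+ n], so the sum grows linearly in [n] while [w] stays bounded by 1. *)
pose w x := if x \in s then lam ^+ (n - index x s) else 0.
have wb k : (k < n.+1)%N -> w (b k) = lam ^+ (n - k).
  move=> kn; have bk : b k = nth (b 0%N) s k by rewrite nth_mkseq.
  have ss : size s = n.+1 by rewrite size_mkseq.
  by rewrite /w bk mem_nth ?ss// index_uniq ?ss// mkseq_uniq.
have wa k : w (a k) = 0.
  by rewrite /w ifN//; apply/negP => /mapP[j _ /ab].
have w1 x : normc (w x) <= 1.
  rewrite /w; case: ifP => _; last by rewrite normc0.
  by rewrite normcX exprn_ile1// normc_ge0.
have [g [g0 g1 gw]] := C0_interpolation R X (s ++ mkseq a n.+1) w hX lcX w1.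
have [f [f0 fg]] := surj _ g0.
have tele m : \sum_(0 <= k < m.+1) lam ^+ k * (g (a k) - g (b k)) =
    - lam ^+ m.+1 * (f (a m) - f (b m)).
  elim: m => [|m IH].
    by rewrite big_nat1 expr0 expr1 -!fg tab; ring.
  by rewrite big_nat_recr//= IH -!fg ta tb !exprSr; ring.
have : \sum_(0 <= k < n.+1) lam ^+ k * (g (a k) - g (b k)) = - lam ^+ n *+ n.+1.
  rewrite -[in RHS](subn0 n.+1) -sumr_const_nat; apply: eq_big_nat => k /andP[_ kn].
  have kin (c : nat -> X) : c k \in mkseq c n.+1.
    by apply/mapP; exists k => //; rewrite mem_iota.
  rewrite !gw ?mem_cat ?kin ?orbT// wa wb// sub0r mulrN -exprD subnKC//.
rewrite tele exprSr -mulNr -mulrA -[RHS]mulr_natr => /mulfI.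
rewrite oppr_eq0 => /(_ ln0) e.
have fM x : normc (f x) <= `|M|.
  by rewrite (le_trans _ (ler_norm M))// -[M]mulr1; apply: (hM f g).
have : normc (lam * (f (a n) - f (b n))) = n.+1%:R.
  by rewrite e -(rmorph_nat (real_complex R)) normc_real ger0_norm.
move=> h; move: nM; rewrite -h normcM ltNge => /negP; apply.
rewrite ler_wpM2l ?normc_ge0// (le_trans (ler_normcB _ _ _))// mulr2n lerD//.
Qed.

Lemma not_comp_resolvent_not_injective (R : realType) (X : topologicalType)
    (tau s : X -> X) (Y : set X) (a b : X) (lam : R[i]) :
  hausdorff_space X -> locally_compact [set: X] ->
  (forall y, Y y -> Y (s y) /\ tau (s y) = y) -> Y a -> Y b -> a <> b ->
  tau a = tau b -> normc lam <= 1 -> ~ comp_resolvent tau lam.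
Proof.
move=> hX lcX hs.
(* If both points were periodic, a common period would give [a = b]. *)
wlog bper : a b / forall m, iter m.+1 tau b <> b.
  move=> wl Ya Yb ab tab.
  have [[m bm]|bper] := pselect (exists m, iter m.+1 tau b = b); last first.
    by apply: wl Ya Yb ab tab => m bm; apply: bper; exists m.
  have [[p ap]|aper] := pselect (exists p, iter p.+1 tau a = a); last first.
    apply: wl Yb Ya _ _ => // [p ap|ba]; first by apply: aper; exists p.
    exact: ab.
  case: ab.
  have per c q (j : nat) : iter q tau c = c -> iter (j * q) tau c = c.
    by move=> cq; elim: j => // j IH; rewrite mulSn iterD IH.
  rewrite -(per a _ m.+1 ap) -(per b _ p.+1 bm) (mulnC p.+1).
  by rewrite mulSn addSn !iterSr tab.
move=> Ya Yb ab tab l1.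
have [a_ [a0 ta ab_]] := backward_orbit_avoiding _ _ _ _ _ _ hs Ya ab tab bper.
have Yk k : Y (iter k s b) by elim: k => // k /hs[].
have tk k : iter k tau (iter k s b) = b.
  by elim: k => // k IH; rewrite iterSr iterS (hs _ (Yk k)).2.
have tak j k : iter j tau (a_ (j + k)%N) = a_ k.
  by elim: j => // j IH; rewrite iterSr addSn ta.
have tbk j k : iter j tau (iter (j + k) s b) = iter k s b.
  by elim: j => // j IH; rewrite iterSr addSn iterS (hs _ (Yk _)).2.
have ne j d : iter j s b <> iter (j + d.+1) s b.
  move=> e; apply: (bper d); rewrite -[in LHS](tk j) e tbk; exact: tk.
apply: (not_comp_resolvent_two_orbits _ _ _ a_ (fun k => iter k s b)) => //.
- by move=> k; rewrite iterS (hs _ (Yk k)).2.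
- by rewrite a0.
- move=> j k e; have [jk|kj|//] := ltngtP j k.
    by case: (ne j (k - j).-1); rewrite prednK ?subn_gt0// subnKC// ltnW.
  by case: (ne k (j - k).-1); rewrite prednK ?subn_gt0// subnKC// ltnW.
(* Pushing a coincidence forward gives either [a_ (j - k) = b], which is excluded, or [a] on the
   backward orbit of [b]; in the latter case [tau a = tau b] makes [b] periodic. *)
- move=> j k e; have [kj|jk] := leqP k j.
    apply: (ab_ (j - k)%N); rewrite -(tak k) subnKC// e -[RHS](tk k).
    by [].
  have := tbk j (k - j.+1).+1; rewrite addnS -addSn subnKC// -e.
  have := tak j 0%N; rewrite addn0 => ->; rewrite a0 => /(congr1 (iter (k - j.+1).+1 tau)).
  by rewrite tk iterSr tab -iterSr; exact: bper.
Qed.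

(** * Strictly decreasing ranges *)

(** Each further time is handled by disjoint neighbourhoods [A] of [x] and [B] of its iterate:
    shrinking to [A] and to the preimage of [B] rules out a return at that time. *)
Lemma nonreturning_nbhs (X : topologicalType) (tau : X -> X) (x : X) n :
  hausdorff_space X -> continuous tau -> (forall k, iter k.+1 tau x <> x) ->
  exists2 U, nbhs x U &
    forall z k, U z -> (k < n)%N -> ~ U (iter k.+1 tau z).
Proof.
move=> hX tc hx; elim: n => [|n [U nU hU]]; first by exists setT => //; exact: filterT.
have := hX; rewrite open_hausdorff => /(_ x (iter n.+1 tau x)).
move=> /(_ (introN eqP (fun e => hx n (esym e)))).
move=> [[A B] /= [/set_mem Ax /set_mem Bx] [oA oB /eqP AB]].
exists (U `&` (A `&` iter n.+1 tau @^-1` B)).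
  apply: filterI => //; apply: filterI; first exact: open_nbhs_nbhs.
  by apply: (continuous_iter _ _ n.+1 tc); exact: open_nbhs_nbhs.
move=> z k [Uz [Az Bz]]; rewrite ltnS leq_eqVlt => /predU1P[->|kn] [Uk [Ak _]].
  by have : (A `&` B) (iter n.+1 tau z) by []; rewrite AB.
exact: (hU z k).
Qed.

(* An approximate eigenvector: the weights [lam ^+ (n - k) * k.+1 / n.+1] along a
   nonreturning orbit grow so slowly that [f \o tau - lam f] is of size 1/(n+1),
   while [f = 1] at the start of an orbit reaching [x] at time [n]. *)
Lemma not_comp_resolvent_strict_ranges (R : realType) (X : topologicalType)
    (tau : X -> X) (lam : R[i]) :
  hausdorff_space X -> locally_compact [set: X] ->
  continuous tau -> proper_map tau ->
  (forall n : nat, range (iter n.+1 tau) <> range (iter n tau)) ->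
  normc lam <= 1 -> ~ comp_resolvent tau lam.
Proof.
move=> hX lcX tc tp hn l1 [_ [_ [M hM]]].
have [n Mn] : exists n, `|M| < n.+1%:R.
  by exists (Num.truncn `|M|); exact: truncnS_gt.
have [y xn] : exists y, ~ range (iter n.+1 tau) (iter n tau y).
  apply: contrapT => /forallNP h; apply: (hn n); apply/seteqP; split.
    by move=> _ [z _ <-]; exists (tau z) => //; rewrite -iterSr.
  by move=> _ [z _ <-]; apply: contrapT; exact: h.
set x := iter n tau y in xn.
have far z k : (n < k)%N -> range (iter n.+1 tau) (iter k tau z).
  by move=> nk; exists (iter (k - n.+1) tau z) => //; rewrite -iterD subnKC.
have [k xk|V nV hV] := nonreturning_nbhs _ tau x n hX tc.
  by apply: xn; rewrite -xk /x -iterD; apply: far; rewrite addSn ltnS leq_addl.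
(* [V] forbids returns within [n] steps, and removing the range forbids all later ones. *)
pose U := V `&` ~` range (iter n.+1 tau).
have nU : nbhs x U.
  apply: filterI => //; apply: open_nbhs_nbhs; split => //.
  by apply: closed_openC; exact: iter_range_closed.
have hU z k : U z -> ~ U (iter k.+1 tau z).
  move=> [Vz _] [Vk Rk]; have [kn|nk] := ltnP k n; first exact: (hV z k).
  by apply: Rk; exact: far.
have [h [_ h01 hx h0 hC]] := C0_bump R X x U hX lcX nU.
have h_ge0 z : 0 <= h z by have /andP[] := h01 z.
(* An orbit visits [U] at most once, so at most one term is nonzero. *)
have hsum m z : \sum_(0 <= k < m) h (iter k tau z) <= 1.
  elim: m z => [|m IH] z; first by rewrite big_geq.
  rewrite big_nat_recl//=; under eq_bigr do rewrite -iterS iterSr.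
  have [Uz|/h0 ->] := pselect (U z); last by rewrite add0r.
  rewrite big1 ?addr0; first by have /andP[] := h01 z.
  by move=> k _; apply: h0; rewrite -iterSr; exact: hU.
pose H k z : R[i] := (h (iter k tau z))%:C%C.
have HC k : C0 (H k).
  by apply: (C0_comp _ _ (iter k tau) (fun z => (h z)%:C%C)) => //;
    [exact: continuous_iter | exact: proper_iter].
pose c : R[i] := n.+1%:R^-1.
pose f z := \sum_(0 <= k < n.+1) (lam ^+ (n - k) * (k.+1%:R * c)) * H k z.
have fC : C0 f by apply: C0_sum => k; exact: C0Z.
(* In [f (tau z) - lam * f z] the coefficient of [H k] is [lam ^+ (n.+1 - k)] times
   [k * c - k.+1 * c], and the leftover [H n.+1] vanishes since [U] misses the range of
   [iter n.+1 tau]. *)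
pose g z := (- c) * \sum_(0 <= k < n.+1) lam ^+ (n.+1 - k) * H k z.
have gC : C0 g by apply: C0Z; apply: C0_sum => k; exact: C0Z.
have normc_c : normc c = n.+1%:R^-1.
  by rewrite normcV -(rmorph_nat (real_complex R)) normc_real ger0_norm.
have fg z : f (tau z) - lam * f z = g z.
  have HS k : H k (tau z) = H k.+1 z by rewrite /H iterSr.
  rewrite /f /g; under eq_bigr do rewrite HS.
  rewrite big_nat_recr//= (_ : H n.+1 z = 0); last first.
    by rewrite /H h0// => -[_]; apply; exact: far.
  rewrite mulr0 addr0 [X in lam * X]big_nat_recl//= [in RHS]big_nat_recl//=.
  rewrite mulrDr opprD addrCA mulr_sumr -sumrB [in RHS]mulrDr mulr_sumr.
  congr (_ + _); first by rewrite !subn0 mul1r exprS; ring.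
  apply: eq_big_nat => k /andP[_ kn].
  rewrite subSS -[in LHS](subnSK kn) -(subnSK kn) !exprS.
  by rewrite -!natr1; ring.
have gb z : normc (g z) <= n.+1%:R^-1.
  rewrite normcM normc_opp normc_c ler_piMr ?invr_ge0//.
  apply: (le_trans (ler_normc_sum _ _ _)); apply: le_trans (hsum n.+1 z).
  apply: ler_sum => k _; rewrite normcM normc_real ger0_norm//.
  by rewrite ler_piMl// normcX exprn_ile1// normc_ge0.
(* Only [k = n] contributes: an earlier visit of the orbit of [y] to [U] would be followed by a
   return at [x]. *)
have fy : f y = 1.
  rewrite /f big_nat_recr//= big_nat_cond big1 ?add0r.
    rewrite subnn expr0 mul1r /c mulfV ?mul1r ?pnatr_eq0// /H -/x hx.
    by [].
  move=> k /andP[/andP[_ kn] _]; rewrite /H h0 ?mulr0// => Uk.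
  have := hU _ (n - k).-1 Uk; rewrite prednK ?subn_gt0// -iterD.
  rewrite subnK; last exact: ltnW.
  by apply; exact: nbhs_singleton.
have := hM f g _ fC gC fg gb y; rewrite fy normc1 ler_pdivlMr// mul1r => nM.
have := le_lt_trans (le_trans nM (ler_norm M)) Mn.
by rewrite ltxx.
Qed.

(** * The spectrum *)

Lemma comp_spectrum_eq_disk (R : realType) (X : topologicalType) (tau : X -> X) :
  continuous tau -> proper_map tau ->
  (forall lam : R[i], normc lam <= 1 -> ~ comp_resolvent tau lam) ->
  comp_spectrum (R:=R) tau = cdisk (R:=R).
Proof.
move=> tc tp h; apply/seteqP; split=> lam; last exact: h.
rewrite /comp_spectrum /cdisk /= => nr; rewrite leNgt; apply/negP => l1.
by apply: nr; exact: comp_resolvent_gt1.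
Qed.

Lemma comp_spectrum_stable_dichotomy (R : realType) (X : topologicalType)
    (tau : X -> X) n :
  hausdorff_space X -> locally_compact [set: X] ->
  continuous tau -> proper_map tau ->
  range (iter n.+1 tau) = range (iter n tau) ->
  comp_spectrum (R:=R) tau = cdisk (R:=R) \/
  (forall lam : R[i], 0 < normc lam < 1 -> ~ comp_spectrum (R:=R) tau lam).
Proof.
move=> hX lcX tc tp hn.
have [inj|] := pselect (forall x y, range (iter n tau) x ->
    range (iter n tau) y -> tau x = tau y -> x = y).
  right => lam l01; apply; exact: comp_resolvent_injective hn inj l01.
move=> /existsNP[a /existsNP[b]]; rewrite !not_implyE => -[Ya [Yb [tab ab]]].
have [s hs] := stable_range_section _ _ _ hn.
left; apply: comp_spectrum_eq_disk => // lam.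
exact: (not_comp_resolvent_not_injective _ _ _ s (range (iter n tau)) a b).
Qed.

(** The range of [tau] is closed, so a bump supported off it is a nonzero function killed by
    composition with [tau]. *)
Lemma comp_spectrum0 (R : realType) (X : topologicalType) (tau : X -> X) :
  hausdorff_space X -> locally_compact [set: X] ->
  continuous tau -> proper_map tau ->
  range tau <> [set: X] -> comp_spectrum (R:=R) tau 0.
Proof.
move=> hX lcX tc tp ntau [_ [inj _]].
have [x xn] : exists x, ~ range tau x.
  by apply: contrapT => /forallNP h; apply: ntau; apply/seteqP; split => // x _;
    apply: contrapT; exact: h.
have nU : nbhs x (~` range tau).
  apply: open_nbhs_nbhs; split => //; apply: closed_openC.
  exact: (iter_range_closed X tau 1).
have [h [_ _ hx h0 hC]] := C0_bump R X x _ hX lcX nU.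
have := inj _ hC _ x; rewrite hx => h10.
have /eqP : (1 : R)%:C%C = 0.
  apply: h10 => z; rewrite mul0r subr0 h0//.
  by apply; exists z.
by rewrite oner_eq0.
Qed.

Theorem theorem4p3 (R : realType) (X : topologicalType)
  (hX : hausdorff_space X) (lcX : locally_compact [set: X])
  (tau : X -> X) (tau_cont : continuous tau) (tau_proper : proper_map tau) :
  (comp_spectrum (R:=R) tau = cdisk (R:=R) \/
     (forall lam : R[i], 0 < normc lam < 1 -> ~ comp_spectrum (R:=R) tau lam)) /\
  (range tau <> [set: X] -> comp_spectrum (R:=R) tau 0) /\
  ((forall n : nat, range (iter n.+1 tau) <> range (iter n tau)) ->
     comp_spectrum (R:=R) tau = cdisk (R:=R)) /\
  ((exists n0 : nat, range (iter n0.+1 tau) = range (iter n0 tau)) ->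
     comp_spectrum (R:=R) tau = cdisk (R:=R) \/
     comp_spectrum (R:=R) tau `<=` ccircle (R:=R) `|` [set 0]).
Proof.
have dich : comp_spectrum (R:=R) tau = cdisk (R:=R) \/
    (forall lam : R[i], 0 < normc lam < 1 -> ~ comp_spectrum (R:=R) tau lam).
  have [[n hn]|/forallNP hn] :=
      pselect (exists n, range (iter n.+1 tau) = range (iter n tau)).
    exact: comp_spectrum_stable_dichotomy hn.
  left; apply: comp_spectrum_eq_disk => // lam.
  exact: not_comp_resolvent_strict_ranges.
split=> //; split; first exact: comp_spectrum0.
split=> [hn|_].
  apply: comp_spectrum_eq_disk => // lam.
  exact: not_comp_resolvent_strict_ranges.
case: dich => [|res]; first by left.
right=> lam slam; have [l1|l1|] := ltgtP (normc lam) 1; last by left.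
  right; apply/eqP; rewrite -normc_eq0 eq_le normc_ge0 andbT leNgt.
  by apply/negP => l0; apply: (res lam) => //; rewrite l0.
by case: slam; exact: comp_resolvent_gt1.
Qed.
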